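(* As $n\to\infty$, $$\min_{x,y\in[-n,n],\ x\neq y}\mathcal{P}\Bigl(\mathbb{E}^{\sigma}_{x}(\tau_{y})\ge \frac{n}{18}\Bigr)=1-o(1),$$ where $\mathcal{P}$ is the uniform probability measure on permutations $\sigma\in S_{[-n,n]}$ and $\mathbb{E}^{\sigma}_x(\tau_y)$ is the expected hitting time of $y$ for the permuted walk $X_\sigma$ started from $x$.
   Context: For a positive integer $n$, $[-n,n]$ denotes the set of integers $\{-n,-n+1,\ldots,n\}$ and $S_{[-n,n]}$ the set of its permutations. Given $\sigma\in S_{[-n,n]}$, the permuted walk $X_\sigma$ is the discrete-time Markov chain on $[-n,n]$ with the following transitions: from $x\notin\{-n,n\}$ it jumps to $\sigma(x-1)$ or $\sigma(x+1)$ with probability $1/2$ each; from $-n$ it jumps to $\sigma(-n)$ or $\sigma(-n+1)$ with probability $1/2$ each; from $n$ it jumps to $\sigma(n-1)$ or $\sigma(n)$ with probability $1/2$ each. For $y\in[-n,n]$, $\tau_y=\min\{t\ge 0: X_\sigma(t)=y\}$ is the hitting time of $y$, and $\mathbb{E}^\sigma_x(\tau_y)$ is its expectation when $X_\sigma$ is started from $x$. *)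

(* Defs.v *)
From HB Require Import structures.
From mathcomp Require Import all_boot all_order all_algebra all_fingroup.
From mathcomp Require Import all_classical all_reals all_analysis.
From mathcomp Require Import zify ring lra.
Set Implicit Arguments.
Unset Strict Implicit.
Unset Printing Implicit Defensive.
Import Order.TTheory GRing.Theory Num.Theory numFieldNormedType.Exports.
Local Open Scope classical_set_scope.
Local Open Scope ring_scope.

(* The interval [-n, n] of integers: the ordinal i stands for the integer
   i - n, so that ord0 is -n and ord_max is n. *)
Definition site (n : nat) := 'I_(n.*2.+1).

(* x - 1, except that -n is sent to itself. *)
Definition left_nbr (n : nat) (x : site n) : site n := inord x.-1.

(* x + 1, except that n is sent to itself. *)
Definition right_nbr (n : nat) (x : site n) : site n := inord (minn x.+1 n.*2).

(* Transition probabilities of X_sigma.  Since the endpoints are their own left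
   (resp. right) neighbour, this covers the transitions from -n and n too. *)
Definition step_prob (R : realType) (n : nat) (sigma : {perm site n})
    (x z : site n) : R :=
  2^-1 * (z == sigma (left_nbr x))%:R + 2^-1 * (z == sigma (right_nbr x))%:R.

(* X is a discrete-time Markov chain on the finite set S, with transition
   matrix K and started from x.  The Markov property is written without
   conditional probabilities, so that null histories need no special case. *)
Definition markov_chain (R : realType) (S : finType) (K : S -> S -> R) (x : S)
    (d : measure_display) (Omega : measurableType d) (P : probability Omega R)
    (X : nat -> Omega -> S) : Prop :=
  [/\ forall t z, measurable [set w | X t w = z],
      P [set w | X 0%N w = x] = 1%E
    & forall t (p : nat -> S),
        P [set w | forall s, (s <= t.+1)%N -> X s w = p s] =
        (P [set w | forall s, (s <= t)%N -> X s w = p s] *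
         (K (p t) (p t.+1))%:E)%E].

(* A realization, on some probability space, of X_sigma started from x. *)
Record permuted_walk (R : realType) (n : nat) (sigma : {perm site n})
    (x : site n) := PermutedWalk {
  walk_display : measure_display;
  walk_space : measurableType walk_display;
  walk_prob : probability walk_space R;
  walk : nat -> walk_space -> site n;
  walkP : markov_chain (step_prob R sigma) x walk_prob walk }.

(* The value is +oo when y is never visited. *)
Definition hitting_time (R : realType) (n : nat) (sigma : {perm site n})
    (x : site n) (X : permuted_walk R sigma x) (y : site n)
    (w : walk_space X) : \bar R :=
  ereal_inf [set (t%:R)%:E | t in [set t : nat | walk t w = y]].

Definition expected_hitting_time (R : realType) (n : nat)
    (sigma : {perm site n}) (x : site n) (X : permuted_walk R sigma x)
    (y : site n) : \bar R :=
  (\int[walk_prob X]_w hitting_time y w)%E.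

Definition uniform_perm_prob (R : realType) (n : nat)
    (A : pred {perm site n}) : R :=
  #|A|%:R / #|{: {perm site n}}|%:R.

(* Every permuted_walk sigma x is inhabited: drive the walk by the binary digits
   of a uniform random point of [0, 1]; code t w is the integer formed by the
   first t digits of w. *)
Module FlipWalk.
Section FlipWalk.
Variable R : realType.
Let P : probability (measurableTypeR R) R := uniform_prob (@ltr01 R).

Definition code (t : nat) (w : R) : nat := Num.truncn (2 ^+ t * w).

Lemma code_half t w : code t w = (code t.+1 w)./2.
Proof.
rewrite /code exprS -mulrA; set y := 2 ^+ t * w.
have [y0|y0] := leP 0 y; last first.
  have h (z : R) : z < 0 -> Num.truncn z = 0%N.
    by move=> z0; apply/truncn0Pn; rewrite -ltNge (lt_trans z0).
  by rewrite !h // pmulr_rlt0.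
apply: truncn_def.
have /truncn_itv/andP[] : 0 <= 2 * y by lra.
set m := Num.truncn _.
rewrite -[in X in X -> _](odd_double_half m) -[in X in _ -> X -> _](odd_double_half m).
rewrite -!muln2 -addn1 !natrD !natrM => h1 h2.
rewrite -addn1 natrD; case: (odd m) h1 h2 => /= h1 h2; lra.
Qed.

Lemma measurable_le t k : measurable [set w | (code t w <= k)%N].
Proof.
have -> : [set w | (code t w <= k)%N] =
    [set` `]-oo, (k.+1%:R / 2 ^+ t)%R[].
  apply/seteqP; split => w /=; rewrite in_itv /= /code truncn_le_nat.
    by rewrite ltr_pdivlMr ?exprn_gt0// mulrC.
  by rewrite ltr_pdivlMr ?exprn_gt0// mulrC.
exact: measurable_itv.
Qed.

Lemma measurable_code1 t k : measurable [set w | code t w = k].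
Proof.
case: k => [|k].
  have -> : [set w | code t w = 0%N] = [set w | (code t w <= 0)%N].
    by apply/seteqP; split => w /=; rewrite leqn0 => /eqP.
  exact: measurable_le.
have -> : [set w | code t w = k.+1] =
    [set w | (code t w <= k.+1)%N] `\` [set w | (code t w <= k)%N].
  apply/seteqP; split => w /=; first by move=> ->; rewrite leqnn ltnn.
  by case; lia.
by apply: measurableD; exact: measurable_le.
Qed.

Lemma code_bigcup t (f : nat -> bool) : [set w | f (code t w)] =
  \bigcup_(k in [set` f]) [set w | code t w = k].
Proof.
apply/seteqP; split => w /=; first by move=> h; exists (code t w).
by move=> [k /= fk ->].
Qed.

Lemma measurable_code t (f : nat -> bool) : measurable [set w | f (code t w)].
Proof.
by rewrite code_bigcup; apply: bigcup_measurable => k _; exact: measurable_code1.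
Qed.

Lemma PE U : measurable U -> P U = lebesgue_measure (U `&` `[0, 1]).
Proof.
move=> mU; rewrite /P [LHS]integral_uniform_pdf.
rewrite (eq_integral (fun=> 1%E)); last first.
  move=> x; rewrite inE /= => -[_]; rewrite in_itv/= /uniform_pdf => ->.
  by rewrite subr0 invr1.
by rewrite integral_cst ?mul1e//; exact: measurableI.
Qed.

Lemma P_code1 t k :
  P [set w | code t w = k] = (if (k < 2 ^ t)%N then (2 ^- t)%:E else 0)%E.
Proof.
have p0 : 0 < 2 ^+ t :> R by rewrite exprn_gt0.
rewrite PE; last exact: measurable_code1.
case: ifPn => kt.
  have -> : [set w | code t w = k] `&` `[0, 1] =
     [set` `[(k%:R / 2 ^+ t)%R, (k.+1%:R / 2 ^+ t)%R[].
    have e w : (0 <= w) -> (code t w = k) <->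
       (k%:R / 2 ^+ t <= w < k.+1%:R / 2 ^+ t).
      move=> w0; rewrite ler_pdivrMr // ltr_pdivlMr // ![w * _]mulrC.
      have /truncn_eq h : 0 <= 2 ^+ t * w by rewrite mulr_ge0 // ltW.
      by rewrite -h; split=> /eqP.
    apply/seteqP; split => w /=; rewrite !in_itv /=.
      by case=> h /andP[w0 _]; apply/e.
    move=> h; have w0 : 0 <= w.
      by case/andP: h => + _; apply: le_trans; rewrite divr_ge0 // ltW.
    split; first exact/e.
    rewrite w0 /=; case/andP: h => _ /ltW /le_trans; apply.
    by rewrite ler_pdivrMr // mul1r -natrX ler_nat.
  rewrite lebesgue_measure_itv /= lte_fin ltr_pM2r ?invr_gt0 // ltr_nat ltnSn.
  by rewrite -EFinD -mulrBl -natrB // subSnn mul1r.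
apply/eqP; rewrite eq_le measure_ge0 andbT -(lebesgue_measure_set1 (1:R)).
apply: le_measure; rewrite ?inE //.
  by apply: measurableI => //; exact: measurable_code1.
move=> w /= [h]; rewrite in_itv /= => /andP[w0 w1].
apply/eqP; rewrite eq_le w1 /=.
move: kt; rewrite -leqNgt -h /code truncn_ge_nat ?mulr_ge0 ?(ltW p0) //.
by rewrite natrX ler_pMr.
Qed.

Lemma P_bit t (f : nat -> bool) (b : bool) :
  P [set w | f (code t w) && (odd (code t.+1 w) == b)] =
  (2^-1%:E * P [set w | f (code t w)])%E.
Proof.
pose F b' k := [set w | code t.+1 w = (b' + k.*2)%N].
have -> : [set w | f (code t w) && (odd (code t.+1 w) == b)] =
   \bigcup_(k in [set` f]) F b k.
  apply/seteqP; split => w /=; rewrite code_half.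
    move=> /andP[fw /eqP bw]; exists (code t.+1 w)./2 => //.
    by rewrite /F /= -bw odd_double_half.
  move=> [k /= fk ->]; have {}fk : f k := fk.
  by rewrite half_bit_double fk oddD odd_double addbF; case: b.
rewrite code_bigcup !measure_bigcup; last 4 first.
- by move=> k _; exact: measurable_code1.
- by move=> i j _ _ [w [/= -> ->]].
- by move=> k _; exact: measurable_code1.
- by move=> i j _ _ [w []]; rewrite /F /= => ->; case: b; lia.
rewrite -nneseriesZl; last by [].
apply: eq_eseriesr => k _.
transitivity ((2^-1 : R)%:E * (if (k < 2 ^ t)%N then (2 ^- t)%:E else 0%R) : \bar R)%E; last first.
  by congr (_ * _)%E; symmetry; exact: P_code1.
rewrite [LHS](P_code1 t.+1 (b + k.*2)).
rewrite expnS; have -> : (b + k.*2 < 2 * 2 ^ t)%N = (k < 2 ^ t)%N by case: b; lia.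
by case: ifP => _; rewrite ?mule0// -EFinM exprS invfM.
Qed.

Variables (n : nat) (sigma : {perm site n}) (x : site n).

Definition flip_move (y : site n) (b : bool) : site n :=
  sigma (if b then right_nbr y else left_nbr y).

Fixpoint flip_walk (t : nat) (w : R) : site n :=
  if t is t'.+1 then flip_move (flip_walk t' w) (odd (code t w)) else x.

Lemma flip_walk_code t :
  exists G : nat -> site n, forall w, flip_walk t w = G (code t w).
Proof.
elim: t => [|t [G IH]]; first by exists (fun=> x).
by exists (fun k => flip_move (G k./2) (odd k)) => w /=; rewrite IH code_half.
Qed.

Lemma flip_walk_path t (p : nat -> site n) :
  exists f : nat -> bool, 
   [set w | forall s, (s <= t)%N -> flip_walk s w = p s] = [set w | f (code t w)].
Proof.
elim: t => [|t [f IH]].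
  exists (fun=> x == p 0%N); apply/seteqP; split => w /=.
    by move=> /(_ 0%N isT) /= ->.
  by move=> /eqP h [|s].
exists (fun k => f k./2 && (flip_move (p t) (odd k) == p t.+1)).
apply/seteqP; split => w /=.
  move=> h; rewrite -code_half -(h t.+1 (leqnn _)) -(h t) //= eqxx andbT.
  have : [set w | f (code t w)] w by rewrite -IH => s st; apply: h; lia.
  by [].
rewrite -code_half => /andP[fw /eqP e].
have h : [set w | forall s, (s <= t)%N -> flip_walk s w = p s] w by rewrite IH.
move=> s; rewrite leq_eqVlt ltnS => /orP[/eqP ->|]; last exact: h.
by rewrite /= h.
Qed.

Lemma flip_walk_markov : markov_chain (step_prob R sigma) x P flip_walk.
Proof.
split.
- move=> t z; have [G h] := flip_walk_code t.
  under eq_set do rewrite h.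
  rewrite (_ : [set _ | _] = [set w | G (code t w) == z]); last first.
    by apply/seteqP; split => w /= /eqP.
  exact: (measurable_code t (fun k => G k == z)).
- by rewrite (_ : [set _ | _] = setT) ?probability_setT//; apply/seteqP; split.
move=> t p; have [f hf] := flip_walk_path t p.
pose D (b : bool) := [set w | (f (code t w) && (flip_move (p t) b == p t.+1)) && (odd (code t.+1 w) == b)].
have mD b : measurable (D b).
  have -> : D b = [set w | (fun k => f k./2 && (flip_move (p t) b == p t.+1)
                   && (odd k == b)) (code t.+1 w)].
    by apply/seteqP; split => w; rewrite /D /= -code_half.
  exact: (measurable_code t.+1 (fun k => f k./2 && (flip_move (p t) b == p t.+1)
                   && (odd k == b))).
have -> : [set w | forall s, (s <= t.+1)%N -> flip_walk s w = p s] = 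
   D false `|` D true.
  apply/seteqP; split => w /=.
    move=> h; have fw : f (code t w).
      have : [set w | f (code t w)] w by rewrite -hf => s st; apply: h; lia.
      by [].
    have /= := h t.+1 (leqnn _); rewrite (h t) // => e.
    rewrite /D /= fw /=.
    by case: (odd _) e => ->; rewrite eqxx; [right|left].
  move=> h; have fw : f (code t w) by case: h => /andP[/andP[]].
  have h' : [set w | forall s, (s <= t)%N -> flip_walk s w = p s] w by rewrite hf.
  move=> s; rewrite leq_eqVlt ltnS => /orP[/eqP ->|]; last exact: h'.
  by rewrite /= h' //; case: h => /andP[/andP[_ /eqP e] /eqP ->].
transitivity (P (D false) + P (D true))%E.
  apply: measureU; [exact: mD|exact: mD|].
  by apply/seteqP; split => w //= [/andP[_ /eqP h1] /andP[_ /eqP h2]]; rewrite h1 in h2.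
have PD b : P (D b) =
   (2^-1%:E * (P [set w | f (code t w)] * (flip_move (p t) b == p t.+1)%:R%:E))%E.
  rewrite /D (P_bit t (fun k => f k && (flip_move (p t) b == p t.+1))).
  case: eqP => _; first by rewrite mule1; under eq_set do rewrite andbT.
  by rewrite mule0; under eq_set do rewrite andbF; rewrite set_false measure0 ?mule0.
rewrite !PD hf /step_prob.
have Pf : P [set w | f (code t w)] \is a fin_num :=
  fin_num_measure P _ (measurable_code t f).
rewrite -(fineK Pf) -!EFinM -EFinD; congr EFin.
rewrite /flip_move /= !(eq_sym (p t.+1)); ring.
Qed.
End FlipWalk.
End FlipWalk.

Lemma permuted_walk_inhabited (R : realType) (n : nat) (sigma : {perm site n})
    (x : site n) : inhabited (permuted_walk R sigma x).
Proof. exact: (inhabits (PermutedWalk (FlipWalk.flip_walk_markov R sigma x))). Qed.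

(* Main.v *)
Require Import Defs.
From HB Require Import structures.
From mathcomp Require Import all_boot all_order all_algebra all_fingroup.
From mathcomp Require Import all_classical all_reals all_analysis.
From mathcomp Require Import measurable_realfun.
From mathcomp Require Import zify ring lra.
Set Implicit Arguments.
Unset Strict Implicit.
Unset Printing Implicit Defensive.
Import Order.TTheory GRing.Theory Num.Theory numFieldNormedType.Exports.
Local Open Scope classical_set_scope.
Local Open Scope ring_scope.

(** Write N = 2n+1.  The transition matrix is doubly stochastic, so from a
    uniformly random site the probability of hitting y within t steps is at most
    (t+1)/N.  The theorem therefore follows once it is known that, for most
    sigma, the walk started from x is close to uniform after
    T = O(log N) steps and is unlikely to have met y by then: for a time t close
    to n/2 the walk still avoids y up to time T + t with probability at least
    1/4, which already makes the expected hitting time at least n/8.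

    The distance to uniformity is measured in mean square.  Restrict to good
    step sequences, those along which the walk avoids y and no two visited sites
    are equal or share a neighbour, and let W(z) be the mass of the good
    sequences of length T that end at z.  By the inequality
    ab <= N a^2 + b^2/(4N), if h is the probability of hitting y within t steps,
    then
      sum_z W(z) h(z) <= N sum_z (W(z) - 1/N)^2 + (5/4) (sum_z h(z)) / N,
    and sum_z h(z) <= t+1.  The error, N sum (W - 1/N)^2 plus the mass of bad
    sequences ([excess]), is nonnegative and affine in sum W and
    sum W^2, so by Markov's inequality it is enough to compute the averages of
    these two quantities over sigma and to see that the average error tends to
    zero ([sum_excess]).

    - Bad sequences ([count_bad]): along a good sequence each step reads sigma
      at a point that has not been read before, so its value is nearly uniform,
      and the next site is bad with probability O(T/N).

    - Collisions: N sum W^2 is N times the probability that two walks run with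
      the same sigma and independent steps end at the same site.  Two walks that
      coincide at a given time stay together with probability 1/2 at each step;
      two walks at distinct sites meet next if they step to a common neighbour.
      Just before such a meeting the last value of sigma read by the second walk
      is fresh: had it been read earlier by the first walk, the current site of
      the second would be an old site of the first sharing a neighbour with the
      current site of the first, contradicting goodness
      ([count_near_miss]).  Over the four pairs of directions, exactly two
      positions of the second walk, other than that of the first, allow the
      meeting, so that it has probability about 2/(4N) at every step.  Summing
      the geometric series gives N sum W^2 <= N/2^T + N/(N-2T) on average
      ([count_collisions]), that is 1 + o(1).  The sharp constant 1 is what
      makes the variance vanish.

    The principle that a fresh value is uniform is [fresh_value], proved by
    switching that value with another unread one. *)

(** * Neighbours *)

Definition nbr n (b : bool) (z : site n) : site n :=
  if b then right_nbr z else left_nbr z.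

(** The number of ways in which walks at z and z' can step to a common point;
    it is positive exactly when z and z' share a neighbour, and it is the weight
    with which meetings of two walks are counted. *)
Definition links n (z z' : site n) : nat :=
  (\sum_(b : bool) \sum_(c : bool) (nbr b z == nbr c z'))%N.

(** The convention at the two endpoints makes every site, endpoints included,
    the neighbour of exactly two sites counted with direction; this is why the
    walk is doubly stochastic. *)
Lemma sum_nbr_eq n (z : site n) :
  (\sum_(y : site n) \sum_(b : bool) (nbr b y == z) = 2)%N.
Proof.
have count k : (\sum_(y < n.*2.+1) (val y == k) = (k < n.*2.+1))%N.
  elim: (n.*2.+1) => [|m IH]; first by rewrite big_ord0.
  by rewrite big_ord_recr /= IH; lia.
(* z is reached by stepping left from z + 1 (or from 0 if z = 0), and by
   stepping right from z - 1 (or from 2n if z = 2n). *)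
have -> : (\sum_(y : site n) \sum_(b : bool) (nbr b y == z) =
    \sum_(y : site n) ((val y == z.+1) + (val y == 0) * (val z == 0) +
       ((val y == n.*2) * (val z == n.*2) + (val y == z.-1) * (0 < z))))%N.
  apply: eq_bigr => y _; rewrite big_bool /= addnC -!val_eqE.
  have [hy hz] : (y < n.*2.+1 /\ z < n.*2.+1)%N by [].
  rewrite /nbr /left_nbr /right_nbr /= !inordK; [|lia|lia].
  move: (nat_of_ord y) (nat_of_ord z) hy hz => i j; lia.
rewrite !big_split /= -!big_distrl /= !count.
have := ltn_ord z; lia.
Qed.

Lemma sum_nbr (V : nmodType) n (F : site n -> V) :
  \sum_(z : site n) \sum_(b : bool) F (nbr b z) = (\sum_(z : site n) F z) *+ 2.
Proof.
transitivity (\sum_(z : site n) \sum_(y : site n) \sum_(b : bool)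
    F z *+ (nbr b y == z)); last first.
  rewrite -sumrMnl; apply: eq_bigr => z _.
  under eq_bigr do rewrite sumrMnr.
  by rewrite sumrMnr sum_nbr_eq.
rewrite [RHS]exchange_big; apply: eq_bigr => y _.
rewrite [RHS]exchange_big; apply: eq_bigr => b _.
rewrite (bigD1 (nbr b y)) //= eqxx big1 ?addr0 // => z.
by rewrite eq_sym => /negbTE ->.
Qed.

Lemma linksC n (z z' : site n) : links z z' = links z' z.
Proof.
rewrite /links exchange_big; apply: eq_bigr => b _.
by apply: eq_bigr => c _; rewrite eq_sym.
Qed.

Lemma sum_links n (z : site n) : (\sum_(z' : site n) links z z' = 4)%N.
Proof.
rewrite /links exchange_big.
rewrite (eq_bigr (fun=> 2%N)) ?sum_nat_const ?card_bool //= => b _.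
rewrite -(sum_nbr_eq (nbr b z)); apply: eq_bigr => y _.
by apply: eq_bigr => c _; rewrite eq_sym.
Qed.

(** For n = 0 the unique site is its own left and right neighbour. *)
Lemma nbr_inj n (z : site n) : (0 < n)%N -> injective (fun b => nbr b z).
Proof.
move=> n0 b c /= /(congr1 val); rewrite /nbr /left_nbr /right_nbr.
have := ltn_ord z.
by case: b; case: c => //= hz; rewrite !inordK; lia.
Qed.

Lemma links_refl n (z : site n) : (0 < n)%N -> links z z = 2%N.
Proof.
move=> n0; have e b c : (nbr b z == nbr c z) = (b == c).
  exact: (inj_eq (nbr_inj (z := z) n0)).
by rewrite /links !big_bool !e.
Qed.

Lemma links_gt0 n (z z' : site n) b c :
  nbr b z = nbr c z' -> (0 < links z z')%N.
Proof.
by move=> h; rewrite /links (bigD1 b) //= (bigD1 c) //= h eqxx.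
Qed.

(** * Step sequences *)

Fixpoint words (t : nat) : seq (seq bool) :=
  if t is t'.+1 then [seq rcons w b | w <- words t', b <- [:: true; false]]
  else [:: [::]].

Lemma big_wordsS (V : nmodType) t (F : seq bool -> V) :
  \sum_(a <- words t.+1) F a = \sum_(w <- words t) \sum_(b : bool) F (rcons w b).
Proof.
rewrite [words _.+1]/([seq rcons w b | w <- words t, b <- [:: true; false]]).
rewrite big_allpairs_dep.
apply: eq_bigr => w _.
by rewrite !big_cons big_nil big_bool /= addr0.
Qed.

Lemma size_word t a : a \in words t -> size a = t.
Proof.
elim: t a => [|t IH] a; first by rewrite inE => /eqP ->.
by case/allpairsP => -[w b] [/= hw _ ->]; rewrite size_rcons IH.
Qed.

Lemma size_words t : size (words t) = (2 ^ t)%N.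
Proof. by elim: t => [//|t IH]; rewrite [LHS]size_allpairs IH expnS mulnC. Qed.

(** * Trajectories driven by a step sequence *)

Section Walk.
Variables (n : nat) (x : site n).
Implicit Types (s : {perm site n}) (a : seq bool).

Fixpoint inputs_from s (z : site n) a : seq (site n) :=
  if a is b :: a' then nbr b z :: inputs_from s (s (nbr b z)) a' else [::].

(** The points at which sigma is read along the trajectory, in order; the
    trajectory depends on sigma through its values there only. *)
Definition inputs s a := inputs_from s x a.

Definition trace s a := x :: map s (inputs s a).

Definition walk_end s a := last x (map s (inputs s a)).

Lemma inputs_rcons s a b :
  inputs s (rcons a b) = rcons (inputs s a) (nbr b (walk_end s a)).
Proof.
rewrite /inputs /walk_end /inputs.
by elim: a x => [|c a IH] z //=; rewrite IH.
Qed.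

Lemma size_inputs s a : size (inputs s a) = size a.
Proof.
by elim/last_ind: a => [|a b IH] //; rewrite inputs_rcons !size_rcons IH.
Qed.

Lemma walk_end_rcons s a b :
  walk_end s (rcons a b) = s (nbr b (walk_end s a)).
Proof. by rewrite {1}/walk_end inputs_rcons map_rcons last_rcons. Qed.

Lemma trace_rcons s a b :
  trace s (rcons a b) = rcons (trace s a) (walk_end s (rcons a b)).
Proof. by rewrite /trace inputs_rcons map_rcons walk_end_rcons. Qed.

Lemma mem_walk_end s a : walk_end s a \in trace s a.
Proof. exact: mem_last. Qed.

Lemma inputs_local s s' a :
  {in inputs s a, s =1 s'} -> inputs s' a = inputs s a.
Proof.
rewrite /inputs; elim: a x => [//|b a IH] z /= h.
have e : s' (nbr b z) = s (nbr b z) by rewrite h // inE eqxx.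
by rewrite e IH // => u hu; apply: h; rewrite inE hu orbT.
Qed.

Lemma trace_local s s' a :
  {in inputs s a, s =1 s'} -> trace s' a = trace s a.
Proof.
move=> h; rewrite /trace (inputs_local h); congr (_ :: _).
exact/esym/eq_in_map.
Qed.

Lemma walk_end_local s s' a :
  {in inputs s a, s =1 s'} -> walk_end s' a = walk_end s a.
Proof. by move=> /trace_local [h]; rewrite /walk_end h. Qed.

(** Sharing no neighbour is asked rather than mere distinctness: it keeps sigma
    from being read twice at one point, and it prevents a second walk that
    stands on an old site of this one from meeting it at the next step. *)
Definition good (y : site n) s a :=
  (y \notin trace s a) && pairwise (fun z z' => links z z' == 0%N) (trace s a).

(** A weighted count of the ways in which stepping to z would spoil a good
    sequence; being a sum of [links], its total over z is explicit. *)
Definition clash (y : site n) s a (z : site n) : nat :=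
  ((z == y) + \sum_(z' <- trace s a) links z' z)%N.

Lemma good_rcons y s a b :
  good y s (rcons a b) =
    good y s a && (clash y s a (walk_end s (rcons a b)) == 0%N).
Proof.
rewrite /good trace_rcons mem_rcons inE negb_or pairwise_rcons /clash addn_eq0.
rewrite eqb0 (eq_sym y) sum_nat_seq_eq0.
by case: (_ == y); case: (y \in _); case: pairwise; case: all => //=;
  rewrite !(andbT, andbF).
Qed.

Lemma good_nil y s : x != y -> good y s [::].
Proof. by rewrite /good /trace /= inE eq_sym => ->. Qed.

Lemma sum_clash y s a : (\sum_z clash y s a z = (4 * (size a)).+1 + 4)%N.
Proof.
rewrite /clash big_split /= exchange_big /=.
under [X in (_ + X)%N]eq_bigr do rewrite sum_links.
rewrite big_const_seq count_predT iter_addn_0 /= size_map size_inputs.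
rewrite (bigD1 y) //= eqxx big1 => [|z /negbTE -> //]; lia.
Qed.

Lemma mem_inputs s a u : u \in inputs s a ->
  exists a1 b a2, a = a1 ++ b :: a2 /\ u = nbr b (walk_end s a1).
Proof.
elim/last_ind: a => [//|a b IH]; rewrite inputs_rcons mem_rcons inE.
case/orP=> [/eqP ->|/IH [a1 [c [a2 [-> ->]]]]].
  by exists a, b, [::]; rewrite cats1.
by exists a1, c, (rcons a2 b); rewrite rcons_cat.
Qed.

Lemma good_last y s a b z : good y s (rcons a b) -> z \in trace s a ->
  links z (walk_end s (rcons a b)) = 0%N.
Proof.
rewrite good_rcons => /andP[_]; rewrite /clash addn_eq0 sum_nat_seq_eq0.
by move=> /andP[_ /allP h] /h /eqP.
Qed.

Lemma trace_cat s a1 a2 z : z \in trace s a1 -> z \in trace s (a1 ++ a2).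
Proof.
move=> h; elim/last_ind: a2 => [|a b IH]; first by rewrite cats0.
by rewrite -rcons_cat trace_rcons mem_rcons inE IH orbT.
Qed.

(** If the next point to be read had been read before, the current site would
    share that point as a neighbour with an earlier site. *)
Lemma fresh_input y s a b : good y s a -> nbr b (walk_end s a) \notin inputs s a.
Proof.
move=> ga; apply/negP => /mem_inputs [a1 [c [a2 [ea /links_gt0]]]].
rewrite linksC; move: ga; rewrite {}ea -cat_rcons; case/lastP: a2 => [|a2 d].
  by rewrite cats0 => /good_last -> //; exact: mem_walk_end.
rewrite -rcons_cat => /good_last -> //.
by apply: trace_cat; rewrite trace_rcons mem_rcons inE mem_walk_end orbT.
Qed.

End Walk.

(** * A fresh value of a uniform permutation is nearly uniform *)

Section FreshValue.
Local Open Scope nat_scope.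
Variables (T : finType) (A : pred {perm T}) (D : {perm T} -> seq T).
Variables (v : {perm T} -> T) (g : {perm T} -> T -> nat) (m c : nat).
Hypothesis fresh_v : forall s : {perm T},
  A s -> size (D s) <= m /\ v s \notin D s.
Hypothesis local_vg : forall s s' : {perm T},
  A s -> {in D s, s =1 s'} -> v s' = v s /\ g s' =1 g s.
Hypothesis sum_g : forall s : {perm T}, \sum_q g s q <= c.

(** Exchanging the value at v with the unread value p.  The exchange leaves the
    values on D alone, hence v as well, so p and then s can be recovered from
    the new permutation together with the old value at v. *)
Let switch (sp : {perm T} * T) : {perm T} * T :=
  ((sp.1 * tperm (sp.1 (v sp.1)) sp.2)%g, sp.1 (v sp.1)).

Let B := [pred sp : {perm T} * T | A sp.1 && (sp.2 \notin map sp.1 (D sp.1))].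

Let switch_local sp : B sp ->
  v (switch sp).1 = v sp.1 /\ g (switch sp).1 =1 g sp.1.
Proof.
case: sp => s p /= /andP[As pD]; apply: local_vg => // z zD.
rewrite permM tpermD //.
  by apply: contraNneq (fresh_v As).2 => /perm_inj ->.
by apply: contraNneq pD => ->; exact: map_f.
Qed.

Let switch_inj : {in B &, injective switch}.
Proof.
move=> [s p] [s' p'] hB hB' e.
have [hv _] := switch_local hB; have [hv' _] := switch_local hB'.
have e1 := congr1 fst e; have e2 := congr1 snd e.
rewrite e1 {}hv' /= in hv; rewrite /= in e1 e2.
have ep : p = p'.
  have := congr1 (fun t : {perm T} => t (v s)) e1.
  by rewrite /= !permM tpermL -hv tpermL.
move: e1; rewrite e2 ep => /(canRL (mulgK _)) ->.
by rewrite -mulgA mulgV mulg1.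
Qed.

(** Here v s is the point to be read, D s lists the points already read, and
    g s weighs the outcome; v and g may depend on s through the values on D only.
    In terms of averages over s: the mean weight of the value read is at most
    c / (#|T| - m), as if the value were uniform among the
    #|T| - m unread ones. *)
Lemma fresh_value :
  (#|T| - m) * \sum_(s | A s) g s (s (v s)) <= c * #|{perm T}|.
Proof.
apply: (@leq_trans (\sum_(sp | B sp) g (switch sp).1 (switch sp).2)).
  rewrite (eq_bigr (fun sp => g sp.1 (sp.1 (v sp.1)))); last first.
    by move=> sp /switch_local [_ ->].
  rewrite -(pair_big_dep A (fun s p => p \notin map s (D s))
    (fun s _ => g s (s (v s)))) /= big_distrr /=.
  apply: leq_sum => s As; rewrite sum_nat_const leq_mul2r; apply/orP; right.
  rewrite leq_subLR -(cardC (mem (map s (D s)))) leq_add2r.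
  by apply: leq_trans (card_size _) _; rewrite size_map; case: (fresh_v As).
apply: (@leq_trans (\sum_sq g sq.1 sq.2)); last first.
  rewrite -(pair_bigA _ g) /= mulnC -sum_nat_const.
  exact: leq_sum.
rewrite -(big_imset (fun sq => g sq.1 sq.2) switch_inj) /=.
by rewrite [leqRHS](bigID (mem (switch @: B))) /= leq_addr.
Qed.

End FreshValue.

(** * Averages over the permutation *)

Section Counting.
Local Open Scope nat_scope.
Variables (n : nat) (x y : site n) (T : nat).
Let N := #|site n|.
Let Nf := #|{perm site n}|.
Implicit Types (s : {perm site n}) (a b w : seq bool).

(** A union bound over time: at each step of a good sequence the new site is
    fresh, and it clashes with at most 4T + 1 outcomes. *)
Lemma count_bad a : x != y -> size a <= T ->
  (N - T) * \sum_s ~~ good x y s a <= size a * (4 * T + 1) * Nf.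
Proof.
move=> xy; elim/last_ind: a => [|w b IH].
  by move=> _; rewrite big1 ?muln0 // => s _; rewrite good_nil.
rewrite size_rcons => ltwT; have {}IH := IH (ltnW ltwT).
pose v s := nbr b (walk_end x s w).
have := @fresh_value _ (fun s => good x y s w) (fun s => inputs x s w) v
  (fun s => clash x y s w) T (4 * T + 1).
move=> /(_ _ _ _) H.
have {}H : (N - T) * \sum_(s | good x y s w) clash x y s w (s (v s)) <=
    (4 * T + 1) * Nf.
  apply: H => [s gs|s s' gs h|s].
  - by rewrite size_inputs ltnW // (fresh_input b gs).
  - rewrite /v (walk_end_local h); split=> // q.
    by rewrite /clash (trace_local h).
  - by rewrite sum_clash; lia.
rewrite mulSn mulnDl addnC; apply: leq_trans (leq_add IH H).
rewrite -mulnDr leq_mul2l [X in _ + X]big_mkcond -big_split /=.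
apply/orP; right; apply: leq_sum => s _; rewrite good_rcons walk_end_rcons.
by case: good => //=; case: clash.
Qed.

Hypothesis n_gt0 : 0 < n.

Definition collisions s t : nat := \sum_(a <- words t) \sum_(b <- words t)
  [&& good x y s a, good x y s b & walk_end x s a == walk_end x s b].

(** The ways in which two separated good walks can meet at the next step. *)
Definition near_misses s t : nat := \sum_(a <- words t) \sum_(b <- words t)
  [&& good x y s a, good x y s b & walk_end x s a != walk_end x s b] *
    links (walk_end x s a) (walk_end x s b).

(** Walks at the same site stay together under two of the four pairs of steps. *)
Lemma collisionsS s t :
  collisions s t.+1 <= 2 * collisions s t + near_misses s t.
Proof.
rewrite /collisions /near_misses big_wordsS big_distrr -big_split /=.
apply: leq_sum => a _; under eq_bigr => c _ do rewrite big_wordsS.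
rewrite exchange_big big_distrr -big_split /=.
apply: leq_sum => b _.
apply: (@leq_trans ((good x y s a && good x y s b) *
  links (walk_end x s a) (walk_end x s b))).
  rewrite /links big_distrr /=; apply: leq_sum => c _.
  rewrite big_distrr /=; apply: leq_sum => d _.
  rewrite !good_rcons !walk_end_rcons (inj_eq perm_inj).
  case: (good x y s a); case: (good x y s b); rewrite ?andbF //=.
  by rewrite mul1n; case: (_ == nbr _ _); rewrite ?andbF ?leq_b1.
case: (good x y s a); case: (good x y s b) => //=; case: eqP => [->|_] //=.
by rewrite links_refl.
Qed.

(** The value of sigma to be averaged over is the last one read by the second
    walk, v being the point where it is read.  That point cannot be among the
    points read by the first walk: if it was the last of these, the walks are not
    separated; if it was an earlier one, then the second walk stands on an old
    site of the first that shares a neighbour with the current site of the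
    first, which is not good.  Once v is fresh, the constant 2 is the number of
    ways to be linked to a given site from a different one, that is 4 minus the
    2 ways of being linked to itself. *)
Lemma count_near_miss a b : size a = size b -> size a <= T ->
  (N - 2 * T) * (\sum_s
    [&& good x y s a, good x y s b & walk_end x s a != walk_end x s b] *
      links (walk_end x s a) (walk_end x s b)) <= 2 * Nf.
Proof.
case/lastP: b => [|b d].
  by case: a => // _ _; rewrite big1 ?muln0 // => s _; rewrite eqxx !andbF.
case/lastP: a => [|a c]; first by rewrite size_rcons.
rewrite !size_rcons => -[eab] leaT.
set a' := rcons a c.
pose v s := nbr d (walk_end x s b).
pose A s := [&& good x y s a', good x y s b, walk_end x s a' != s (v s)
  & 0 < links (walk_end x s a') (s (v s))].
pose g s q := (q != walk_end x s a') * links (walk_end x s a') q.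
have H : (N - 2 * T) * \sum_(s | A s) g s (s (v s)) <= 2 * Nf.
  apply: (@fresh_value _ A (fun s => inputs x s a' ++ inputs x s b)).
  - move=> s /and4P[ga gb ne near]; split.
      by rewrite size_cat !size_inputs size_rcons; lia.
    rewrite mem_cat (negbTE (fresh_input d gb)) orbF.
    rewrite inputs_rcons mem_rcons inE negb_or; apply/andP; split.
      by apply: contraNneq ne => e; rewrite walk_end_rcons e.
    apply/negP => /(map_f s) vD.
    have /(good_last ga) : s (v s) \in trace x s a by rewrite inE vD orbT.
    by rewrite linksC => e; rewrite e in near.
  - move=> s s' As h.
    have ha : {in inputs x s a', s =1 s'} by move=> u hu; rewrite h // mem_cat hu.
    have hb : {in inputs x s b, s =1 s'}.
      by move=> u hu; rewrite h // mem_cat hu orbT.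
    by rewrite /v /g (walk_end_local ha) (walk_end_local hb).
  - move=> s; rewrite /g; set e := walk_end x s a'.
    rewrite (bigD1 e) //= eqxx add0n (eq_bigr (fun q => links e q)); last first.
      by move=> q ->; rewrite mul1n.
    have := sum_links e; rewrite (bigD1 e) //= => h.
    by rewrite -(leq_add2l (links e e)) h links_refl.
apply: leq_trans H; rewrite leq_mul2l [X in _ <= X]big_mkcond /=.
apply/orP; right; apply: leq_sum => s _.
rewrite good_rcons (walk_end_rcons _ _ b) -/(v s) /A /g (eq_sym (s (v s))).
case: (good x y s a'); case: (good x y s b); rewrite ?andbF //=.
by case: (_ == 0); case: (_ != _) => //=; case: (links _ _).
Qed.

Lemma count_near_misses t : t <= T ->
  (N - 2 * T) * \sum_s near_misses s t <= 4 ^ t * (2 * Nf).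
Proof.
move=> leT; rewrite /near_misses exchange_big big_distrr /=.
rewrite (expnMn 2 2) -mulnA -{1}size_words -sum1_size big_distrl big_seq.
rewrite [leqRHS]big_seq; apply: leq_sum => a ha; rewrite /= mul1n.
rewrite exchange_big big_distrr -size_words -sum1_size big_distrl big_seq.
rewrite [leqRHS]big_seq; apply: leq_sum => b hb; rewrite /= mul1n.
by apply: count_near_miss; rewrite !(size_word ha, size_word hb).
Qed.

(** Solving the recursion of [collisionsS]; after division by 4 ^ t and by the
    number of permutations this is 2 ^ -t + 1 / (N - 2T). *)
Lemma count_collisions t : t <= T ->
  (N - 2 * T) * \sum_s collisions s t <= ((N - 2 * T) * 2 ^ t + 4 ^ t) * Nf.
Proof.
elim: t => [_|t IH ltT].
  rewrite expn0 muln1 (leq_trans (n := (N - 2 * T) * Nf)) //; last first.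
    by rewrite leq_mul2r leq_addr orbT.
  rewrite leq_mul2l -[leqRHS]muln1 -sum_nat_const; apply/orP; right.
  apply: leq_sum => s _; rewrite /collisions /= !big_seq1; exact: leq_b1.
have := IH (ltnW ltT); have := count_near_misses (ltnW ltT).
have : \sum_s collisions s t.+1 <=
    2 * \sum_s collisions s t + \sum_s near_misses s t.
  rewrite big_distrr -big_split; apply: leq_sum => s _; exact: collisionsS.
rewrite !expnS; move: (2 ^ t) (4 ^ t) (N - _) (\sum_s _) (\sum_s _) (\sum_s _).
move=> p q M c1 c d h1 h2 h3; nia.
Qed.

End Counting.

(** * Hitting probabilities and mean-square distance to uniformity *)

Section Hitting.
Variables (R : realType) (n : nat).
Implicit Types (s : {perm site n}) (x y z : site n).

(** The probability that the walk started from z visits y by time t, computed by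
    conditioning on the first step. *)
Fixpoint hit_prob s y (t : nat) z : R :=
  if z == y then 1
  else if t is t'.+1 then (\sum_(b : bool) hit_prob s y t' (s (nbr b z))) / 2
  else 0.

Lemma hit_prob_itv s y t z : 0 <= hit_prob s y t z <= 1.
Proof.
elim: t z => [|t IH] z /=; case: (z == y); rewrite ?lexx ?ler01 //.
rewrite big_bool /=; have := IH (s (nbr true z)); have := IH (s (nbr false z)).
by move=> /andP[? ?] /andP[? ?]; apply/andP; split; lra.
Qed.

Lemma hit_prob_ge0 s y t z : 0 <= hit_prob s y t z.
Proof. by case/andP: (hit_prob_itv s y t z). Qed.

Lemma hit_prob_le1 s y t z : hit_prob s y t z <= 1.
Proof. by case/andP: (hit_prob_itv s y t z). Qed.

(** Each step adds at most 1 to the sum, since the walk preserves the counting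
    measure. *)
Lemma sum_hit_prob s y t : \sum_z hit_prob s y t z <= t.+1%:R.
Proof.
elim: t => [|t IH] /=.
  rewrite (bigD1 y) //= eqxx big1 ?addr0 // => z /negbTE ->; exact: erefl.
rewrite -nat1r; apply: le_trans (lerD (lexx 1) IH).
rewrite [X in _ <= _ + X](reindex_inj (@perm_inj _ s)) /=.
rewrite (bigD1 y) //= eqxx; apply: lerD => //.
rewrite -[leRHS](mulfK (_ : 2 != 0)) // mulr_natr -sum_nbr mulr_suml.
rewrite [leRHS](bigD1 y) //= ler_wpDl //.
  by rewrite big_bool /= mulr_ge0 // addr_ge0 // hit_prob_ge0.
by apply: ler_sum => z /negbTE ->.
Qed.

Definition bad_words x y s t : nat := (\sum_(a <- words t) ~~ good x y s a)%N.

Definition good_hits x y s t z : nat :=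
  (\sum_(a <- words t) (good x y s a && (walk_end x s a == z)))%N.

(** Bad sequences are charged as if they always led to y. *)
Lemma hit_prob_words s x y T t : hit_prob s y (T + t) x <=
  (\sum_(a <- words T)
     if good x y s a then hit_prob s y t (walk_end x s a) else 1) / 2 ^+ T.
Proof.
elim: T t => [|T IH] t.
  rewrite /= big_seq1 divr1; case: ifP => // _.
  exact: hit_prob_le1.
rewrite addSnnS; apply: le_trans (IH _) _; rewrite exprS invfM mulrA.
rewrite ler_pM2r ?invr_gt0 ?exprn_gt0 // ler_pdivlMr // big_wordsS mulr_suml.
apply: ler_sum => w _; rewrite big_bool !good_rcons.
case gw: (good x y s w) => /=; last lra.
have -> : (walk_end x s w == y) = false.
  apply/negbTE; move: gw => /andP[+ _]; apply: contraNneq => <-.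
  exact: mem_walk_end.
rewrite mulfVK // big_bool !walk_end_rcons.
by apply: lerD; case: ifP => // _; exact: hit_prob_le1.
Qed.

Lemma sum_good_hits (F : site n -> R) x y s t :
  \sum_(a <- words t) (if good x y s a then F (walk_end x s a) else 0) =
  \sum_z (good_hits x y s t z)%:R * F z.
Proof.
under [RHS]eq_bigr do rewrite natr_sum mulr_suml.
rewrite exchange_big /=; apply: eq_bigr => a _.
case: good; last by rewrite big1 // => z _; rewrite mul0r.
rewrite (bigD1 (walk_end x s a)) //= eqxx mul1r big1 ?addr0 // => z.
by rewrite eq_sym => /negbTE ->; rewrite mul0r.
Qed.

Lemma sum_good_hits_sqr x y s t :
  \sum_z (good_hits x y s t z)%:R ^+ 2 = (collisions x y s t)%:R :> R.
Proof.
under eq_bigr do rewrite expr2.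
rewrite -sum_good_hits /collisions natr_sum; apply: eq_bigr => a _.
rewrite natr_sum; case: good => /=; last by rewrite big1.
rewrite natr_sum; apply: eq_bigr => b _.
by rewrite eq_sym.
Qed.

Lemma sum_good_hitsE x y s t :
  \sum_z (good_hits x y s t z)%:R = 2 ^+ t - (bad_words x y s t)%:R :> R.
Proof.
under eq_bigr do rewrite -[_%:R]mulr1.
rewrite -(sum_good_hits (fun=> 1)) -natrX -size_words -sum1_size !natr_sum -sumrB.
by apply: eq_bigr => a _; case: good => /=; rewrite ?subr0 ?subrr.
Qed.

(** The error of the comparison with the uniform distribution, written in the
    form whose average over s can be computed; [excessE] shows what it means. *)
Definition excess x y s T : R :=
  n.*2.+1%:R * (collisions x y s T)%:R / 4 ^+ T
    + 3 * (bad_words x y s T)%:R / 2 ^+ T - 1.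

Lemma excessE x y s T : excess x y s T =
  n.*2.+1%:R * \sum_z ((good_hits x y s T z)%:R / 2 ^+ T - n.*2.+1%:R^-1) ^+ 2
    + (bad_words x y s T)%:R / 2 ^+ T.
Proof.
have N0 : n.*2.+1%:R != 0 :> R by rewrite pnatr_eq0.
have M0 : 2 ^+ T != 0 :> R by rewrite expf_neq0.
have -> : \sum_z ((good_hits x y s T z)%:R / 2 ^+ T - n.*2.+1%:R^-1) ^+ 2 =
  (\sum_z (good_hits x y s T z)%:R ^+ 2) / 2 ^+ T ^+ 2 -
  (\sum_z (good_hits x y s T z)%:R) * 2 / 2 ^+ T / n.*2.+1%:R +
   \sum_(z : site n) n.*2.+1%:R ^- 2 :> R.
  rewrite !mulr_suml -sumrB -big_split; apply: eq_bigr => z _ /=.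
  by move: (n.*2.+1%:R : R) (2 ^+ T : R) N0 M0 => N M N0 M0; field; rewrite N0 M0.
rewrite sum_good_hits_sqr sum_good_hitsE sumr_const card_ord -(mulr_natr (_ ^- 2)).
rewrite /excess; have -> : 4 ^+ T = 2 ^+ T ^+ 2 :> R.
  by rewrite exprAC; congr (_ ^+ _); rewrite -natrX.
move: (n.*2.+1%:R : R) (2 ^+ T : R) N0 M0 => N M N0 M0.
by field; rewrite N0 M0.
Qed.

Lemma excess_ge0 x y s T : 0 <= excess x y s T.
Proof.
rewrite excessE addr_ge0 ?divr_ge0 ?exprn_ge0 ?mulr_ge0 ?sumr_ge0 // => z _.
exact: sqr_ge0.
Qed.

(** The density of the good sequences replaced by the uniform density, at the
    cost of the mean-square distance between the two. *)
Lemma hit_prob_le_excess x y s T t : hit_prob s y (T + t) x <=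
  excess x y s T + (5 / 4) * t.+1%:R / n.*2.+1%:R.
Proof.
have N0 : 0 < n.*2.+1%:R :> R by rewrite ltr0n.
apply: le_trans (hit_prob_words _ _ _ _ _) _.
rewrite excessE (eq_bigr (fun a => (if good x y s a then
  hit_prob s y t (walk_end x s a) else 0) + (~~ good x y s a)%:R)); last first.
  by move=> a _; case: good; rewrite ?addr0 ?add0r.
rewrite big_split /= sum_good_hits -natr_sum -/(bad_words _ _ _ _) mulrDl.
rewrite [leRHS]addrAC; apply: lerD => //.
apply: (@le_trans _ _ (n.*2.+1%:R * \sum_z ((good_hits x y s T z)%:R / 2 ^+ T -
  n.*2.+1%:R^-1) ^+ 2 + (5 / 4) * (\sum_z hit_prob s y t z) / n.*2.+1%:R)).
  rewrite mulr_suml !mulr_sumr mulr_suml -big_split; apply: ler_sum => z _ /=.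
  rewrite mulrAC; set w := _ / 2 ^+ T; set h := hit_prob _ _ _ _.
  have /andP[h0 h1] : 0 <= h <= 1 := hit_prob_itv s y t z.
  set N := n.*2.+1%:R in N0 *; set i := N^-1.
  have i0 : 0 <= i by rewrite invr_ge0 ltW.
  have Ni : N * i = 1 by rewrite divff // gt_eqF.
  (* w h = (w - i) h + i h, the first term is at most N (w - i)^2 + i h^2 / 4
     because the following square is nonnegative, and h^2 <= h. *)
  have sq : 0 <= N * (w - i - i * h / 2) ^+ 2 by rewrite mulr_ge0 ?sqr_ge0 // ltW.
  have e : N * (w - i - i * h / 2) ^+ 2 =
    N * (w - i) ^+ 2 - (N * i) * (w - i) * h + (N * i) * i * h ^+ 2 / 4 by field.
  rewrite e Ni !mul1r in sq.
  have : 0 <= i * (h * (1 - h)) by rewrite !mulr_ge0 // subr_ge0.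
  lra.
rewrite lerD2l ler_pM2r ?invr_gt0 // ler_pM2l; last by lra.
exact: sum_hit_prob.
Qed.

End Hitting.

(** * From hitting probabilities to expected hitting times *)

Section WalkHitting.
Variables (R : realType) (n : nat) (s : {perm site n}) (x : site n).
Variables (X : permuted_walk R s x) (y : site n).
Let P := walk_prob X.

(** The one source of measurability: countably many conditions, each on the
    position at one time. *)
Lemma measurable_walk_all (Q : nat -> set (site n)) :
  measurable [set w | forall t, Q t (walk (p := X) t w)].
Proof.
have [mX _ _] := walkP X.
have -> : [set w | forall t, Q t (walk (p := X) t w)] =
    \bigcap_t \bigcup_(z in Q t) [set w | walk (p := X) t w = z].
  apply/seteqP; split=> w /=.
    by move=> h t _; exists (walk t w); rewrite //=; exact: h.
  by move=> h t; have [z Qz /= ->] := h t I.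
apply: bigcapT_measurable => t; apply: fin_bigcup_measurable => [|z _].
  exact: finite_finset.
exact: mX.
Qed.

Let follows (p : nat -> site n) t :=
  [set w | forall r, (r <= t)%N -> walk (p := X) r w = p r].

Let avoids t m :=
  [set w | forall r, (t <= r <= t + m)%N -> walk (p := X) r w <> y].

Let measurable_follows_avoids p t m : measurable (follows p t `&` avoids t m).
Proof.
apply: measurableI.
  exact: (measurable_walk_all (fun r z => (r <= t)%N -> z = p r)).
exact: (measurable_walk_all (fun r z => (t <= r <= t + m)%N -> z <> y)).
Qed.

Lemma sum_step_prob (F : site n -> R) z :
  \sum_z' step_prob R s z z' * F z' = (\sum_(b : bool) F (s (nbr b z))) / 2.
Proof.
have pick u : \sum_z' 2^-1 * (z' == u)%:R * F z' = F u / 2.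
  rewrite (bigD1 u) //= eqxx mulr1 mulrC big1 ?addr0 // => z' /negbTE ->.
  by rewrite mulr0 mul0r.
rewrite /step_prob; under eq_bigr do rewrite mulrDl.
by rewrite big_split /= !pick big_bool mulrDl addrC.
Qed.

(** The Markov property in the form needed, for a prescribed past; the induction
    on m extends that past by one step in every possible way. *)
Lemma follows_avoids_prob p t m : P (follows p t `&` avoids t m) =
  (P (follows p t) * (1 - hit_prob R s y m (p t))%:E)%E.
Proof.
have [_ _ markov] := walkP X.
have empty p1 t1 m1 : p1 t1 = y -> follows p1 t1 `&` avoids t1 m1 = set0.
  move=> pty; apply/seteqP; split=> w //= [fw aw].
  by apply: (aw t1); rewrite ?leqnn ?leq_addr // fw.
elim: m p t => [|m IH] p t.
  rewrite /=; case: eqP => pty; first by rewrite empty // measure0 subrr mule0.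
  rewrite subr0 mule1; congr (P _); apply/seteqP; split=> w /=; first by case.
  move=> fw; split=> // r; rewrite addn0 => /andP[h1 h2].
  by have -> : r = t; [lia | rewrite fw].
rewrite /=; case: eqP => pty; first by rewrite empty // measure0 subrr mule0.
pose p' z r := if r == t.+1 then z else p r.
have p'E z r : (r <= t)%N -> p' z r = p r by rewrite /p'; case: eqP => // ->; lia.
have p'S z : p' z t.+1 = z by rewrite /p' eqxx.
have -> : follows p t `&` avoids t m.+1 =
    \bigcup_(z in [set` (xpredT : pred (site n))])
      (follows (p' z) t.+1 `&` avoids t.+1 m).
  apply/seteqP; split=> w /=.
    case=> fw aw; exists (walk t.+1 w) => //; split=> r /= h; last first.
      by apply: aw; lia.
    move: h; rewrite leq_eqVlt ltnS => /orP[/eqP ->|h]; first by rewrite p'S.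
    by rewrite p'E // fw.
  case=> z _ [fw aw]; split=> r /= h.
    by rewrite fw ?p'E //; lia.
  have [->|h'] : r = t \/ (t < r)%N by lia.
    by rewrite fw // p'E.
  by apply: aw; lia.
rewrite bigcup_pred measure_bigsetU_ord; last 2 first.
- by move=> z; exact: measurable_follows_avoids.
- move=> z z' _ _ [w [[/= fw _] [fw' _]]].
  by rewrite -(p'S z) -(p'S z') -fw // fw'.
rewrite (eq_bigr (fun z => P (follows p t) * (step_prob R s (p t) z *
    (1 - hit_prob R s y m z))%:E)%E); last first.
  move=> z _; rewrite [LHS]IH p'S EFinM muleA; congr (_ * _)%E.
  rewrite [LHS]markov p'S p'E //; congr (P _ * _)%E.
  by apply/seteqP; split=> w /= fw r h; rewrite fw // p'E.
have Pf : P (follows p t) \is a fin_num.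
  apply: fin_num_measure.
  exact: (measurable_walk_all (fun r z => (r <= t)%N -> z = p r)).
rewrite -ge0_sume_distrr; last first.
  move=> z _; rewrite lee_fin mulr_ge0 //.
    by rewrite /step_prob addr_ge0 // mulr_ge0.
  by rewrite subr_ge0 hit_prob_le1.
congr (_ * _)%E; rewrite sumEFin; congr EFin.
rewrite (eq_bigl xpredT) // sum_step_prob sumrB big_const /= card_bool /=.
lra.
Qed.

(** Markov's inequality for the hitting time, which exceeds m on the event that
    y is avoided up to time m. *)
Lemma expected_hitting_time_ge m :
  ((m.+1%:R * (1 - hit_prob R s y m x))%:E <= expected_hitting_time X y)%E.
Proof.
have [_ X0 _] := walkP X.
pose A := follows (fun=> x) 0%N `&` avoids 0%N m.
have mA : measurable A by exact: measurable_follows_avoids.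
have f0 : P (follows (fun=> x) 0%N) = 1%E.
  rewrite -X0; congr (P _); apply/seteqP; split=> w /=; first by apply.
  by move=> h r; rewrite leqn0 => /eqP ->.
have -> : (m.+1%:R * (1 - hit_prob R s y m x))%:E =
    (\int[P]_(w in A) cst m.+1%:R%:E w)%E.
  rewrite integral_cst // EFinM; congr (_ * _)%E; symmetry.
  by apply: (eq_trans (follows_avoids_prob _ _ _)); rewrite f0 mul1e.
have h0 w : (0 <= hitting_time (X := X) y w)%E.
  by apply/ereal_infP => _ [t _ <-]; rewrite lee_fin.
have mh : measurable_fun [set: walk_space X] (hitting_time (X := X) y).
  apply: (measurability _ (ErealGenCInfty.measurableE R)) => //.
  move=> _ [_ [r ->] <-]; rewrite setTI.
  rewrite (_ : _ @^-1` _ = [set w | forall t, walk t w = y -> r <= t%:R]).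
    exact: (measurable_walk_all (fun t z => z = y -> r <= t%:R)).
  apply/seteqP; split=> w /=; rewrite in_itv /= andbT.
    by move=> /ereal_infP h t e; rewrite -lee_fin; apply: h; exists t.
  by move=> h; apply/ereal_infP => _ [t /= e <-]; rewrite lee_fin; exact: h.
apply: (@le_trans _ _ (\int[P]_(w in A) hitting_time y w)%E); last first.
  exact: ge0_subset_integral.
apply: ge0_le_integral => //.
- by move=> w _; rewrite lee_fin.
- exact: measurable_funTS.
- move=> w [_ aw]; apply/ereal_infP => _ [t /= e <-]; rewrite lee_fin ler_nat.
  by rewrite ltnNge; apply/negP => tm; apply: (aw t).
Qed.

End WalkHitting.

(** * The average error and the limit *)

(** The leading terms N / (N - 2T) and 1 cancel, which leaves 2T / (N - 2T)
    together with N / 2^T and the contribution of the bad sequences. *)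
Lemma sum_excess (R : realType) n (x y : site n) T :
  (0 < n)%N -> x != y -> (2 * T < n.*2.+1)%N ->
  \sum_s excess R x y s T <=
    (n.*2.+1%:R / 2 ^+ T + (12 * T ^ 2 + 5 * T)%:R / (n.*2.+1 - 2 * T)%:R) *
      #|{perm site n}|%:R.
Proof.
move=> n0 xy TN.
have hC := count_collisions x y n0 (leqnn T).
have hB : ((n.*2.+1 - 2 * T) * (\sum_s bad_words x y s T) <=
    2 ^ T * (T * (4 * T + 1) * #|{perm site n}|))%N.
  rewrite /bad_words exchange_big big_distrr -size_words -sum1_size big_distrl.
  rewrite big_seq [leqRHS]big_seq; apply: leq_sum => a ha; rewrite /= mul1n.
  have := @count_bad n x y T a xy; rewrite (size_word ha) => /(_ (leqnn T)).
  by apply: leq_trans; rewrite card_ord leq_mul2r; apply/orP; right; lia.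
rewrite card_ord in hC.
move: hC hB; rewrite -!(ler_nat R) !(natrX, natrM, natrD, natr_sum).
rewrite /excess sumrB big_split /= -!mulr_suml -!mulr_sumr sumr_const -mulr_natr mul1r.
have e4 : 4 ^+ T = 2 ^+ T ^+ 2 :> R.
  by rewrite exprAC; congr (_ ^+ _); rewrite -natrX.
have eN : n.*2.+1%:R = (n.*2.+1 - 2 * T)%:R + 2 * T%:R :> R.
  by rewrite -natrM -natrD; congr _%:R; lia.
have D0 : 0 < (n.*2.+1 - 2 * T)%:R :> R by rewrite ltr0n subn_gt0.
have M0 : 0 < 2 ^+ T :> R by rewrite exprn_gt0.
have F0 : 0 <= #|{perm site n}|%:R :> R by [].
have -> : #|[eta @predT {perm site n}]|%:R = #|{perm site n}|%:R :> R by [].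
rewrite e4 {}eN.
move: (_ - _)%:R (2 ^+ T) (#|_|%:R) (\sum_s _) (\sum_s _) D0 M0 F0.
move=> D M F b c D0 M0 F0 hc hb.
set t := T%:R in hc hb *.
have hc' : c / M ^+ 2 <= (1 / M + 1 / D) * F.
  have -> : (1 / M + 1 / D) * F = (D * M + M ^+ 2) * F / D / M ^+ 2.
    by field; rewrite !gt_eqF.
  by rewrite ler_pM2r ?invr_gt0 ?exprn_gt0 // ler_pdivlMr // mulrC.
have hb' : b / M <= t * (4 * t + 1) * F / D.
  rewrite ler_pdivrMr // mulrAC ler_pdivlMr // mulrC; apply: le_trans hb _.
  by rewrite [leRHS]mulrC.
have t0 : 0 <= t by [].
have N0 : 0 <= D + 2 * t by rewrite addr_ge0 ?mulr_ge0 // ltW.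
have := ler_wpM2l N0 hc'.
have -> : (D + 2 * t) * ((1 / M + 1 / D) * F) =
  ((D + 2 * t) / M + 2 * t / D) * F + F by field; rewrite !gt_eqF.
move: hb'; lra.
Qed.

(** Markov's inequality applied to [excess] at level 1/8.  Below that level, and
    for t = n/2 rounded down, the probability of hitting y by time T + t is at
    most 1/8 + (5/4)(1/2) = 3/4. *)
Lemma slow_hitting_prob (R : realType)
    (X : forall (n : nat) (s : {perm site n}) (x : site n), permuted_walk R s x)
    n (x y : site n) T :
  (0 < n)%N -> x != y -> (2 * T < n.*2.+1)%N ->
  1 - 8 * (n.*2.+1%:R / 2 ^+ T +
     (12 * T ^ 2 + 5 * T)%:R / (n.*2.+1 - 2 * T)%:R) <=
  uniform_perm_prob R (fun s : {perm site n} =>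
    ((n%:R / 18)%:E <= expected_hitting_time (X n s x) y)%E).
Proof.
move=> n0 xy TN; rewrite /uniform_perm_prob.
set A := fun s => _; have := sum_excess R n0 xy TN; set err := (_ + _).
have F0 : 0 < #|{perm site n}|%:R :> R.
  by rewrite ltr0n; apply/card_gt0P; exists 1%g.
rewrite ler_pdivlMr // => h.
have : #|[predC A]|%:R <= 8 * \sum_s excess R x y s T.
  rewrite -sum1_card natr_sum mulr_sumr big_mkcond /=; apply: ler_sum => s _.
  case: ifP => [|_]; last by rewrite mulr_ge0 // excess_ge0.
  rewrite inE /= => As; rewrite leNgt; apply: contra As => ex; rewrite /A.
  apply: le_trans (expected_hitting_time_ge (X n s x) y (T + n./2)).
  have := hit_prob_le_excess R x y s T n./2.
  set H := hit_prob _ _ _ _ _; rewrite -mulrA lee_fin.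
  have : (n./2.+1)%:R / n.*2.+1%:R <= 2^-1 :> R.
    rewrite ler_pdivrMr // mulrC ler_pdivlMr // -natrM ler_nat; lia.
  move: (_ / n.*2.+1%:R) => r hr hH.
  have hn : n%:R <= 2 * n./2.+1%:R :> R by rewrite -natrM ler_nat; lia.
  have hT : n./2.+1%:R <= (T + n./2).+1%:R :> R by rewrite ler_nat; lia.
  have H34 : H <= 3 / 4 by lra.
  have n_ge0 : 0 <= n%:R :> R by [].
  apply: (@le_trans _ _ ((T + n./2).+1%:R * 4^-1)); first by lra.
  by rewrite ler_wpM2l //; lra.
have : #|{perm site n}|%:R = #|A|%:R + #|[predC A]|%:R :> R.
  by rewrite -natrD cardC.
rewrite -/err in h *; lra.
Qed.

Lemma cube_le_exp k : (k.+1 ^ 3 <= 16 * 2 ^ k)%N.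
Proof.
have [|k4] := ltnP k 4; first by case: k => [|[|[|[|]]]].
rewrite -(subnK k4); elim: (k - 4)%N => [//|j IH].
rewrite addSn expnS; move: IH; set m := (j + 4)%N.
have : (4 <= m)%N by rewrite leq_addl.
rewrite !expnS expn0; move: (2 ^ m)%N => p; nia.
Qed.

(** T = 2 (k + 1) makes 2^T exceed N^2, so that both terms of the error are at
    most of order (log N)^2 / N; k^3 = O(2^k) turns this into O(1 / log N).
    From k = 6 on, 2T is at most N/2. *)
Lemma error_bound (R : realType) N k : (6 <= k)%N -> (2 ^ k <= N < 2 ^ k.+1)%N ->
  let T := (2 * k.+1)%N in
  (2 * T < N)%N /\
  N%:R / 2 ^+ T + (12 * T ^ 2 + 5 * T)%:R / (N - 2 * T)%:R <= 2000 / k.+1%:R :> R.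
Proof.
move=> k6 /andP[kN Nk] /=; set T := (2 * k.+1)%N.
have k8 : (8 * k.+1 <= 2 ^ k)%N.
  rewrite -(subnK k6); elim: (k - 6)%N => [//|j IH].
  rewrite addSn expnS; move: IH; move: (2 ^ _)%N => p; lia.
have TN : (2 * T <= 2 ^ k)%N by rewrite /T; lia.
split; first by rewrite /T; lia.
have m0 : 0 < k.+1%:R :> R by [].
have Q0 : 0 < 2 ^+ k :> R by rewrite exprn_gt0.
have -> : 2 ^+ T = 4 * (2 ^+ k) ^+ 2 :> R.
  by rewrite /T mulnC exprM (exprS _ k); move: (2 ^+ k) => Q; ring.
have h8 : 8 * k.+1%:R <= 2 ^+ k :> R by rewrite -natrX -natrM ler_nat.
have h3 : k.+1%:R ^+ 3 <= 16 * 2 ^+ k :> R.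
  by rewrite -!natrX -natrM ler_nat cube_le_exp.
have hN : N%:R <= 2 * 2 ^+ k :> R by rewrite -exprS -natrX ler_nat ltnW.
have hD : 2 ^+ k / 2 <= (N - 2 * T)%:R :> R.
  by rewrite ler_pdivrMr // -natrX -natrM ler_nat /T; lia.
have hT : (12 * T ^ 2 + 5 * T)%:R <= 58 * k.+1%:R ^+ 2 :> R.
  by rewrite -natrX -natrM ler_nat /T; nia.
move: (2 ^+ k) (k.+1%:R : R) (N%:R : R) ((12 * T ^ 2 + 5 * T)%:R : R)
  ((N - 2 * T)%:R : R) m0 Q0 h8 h3 hN hD hT.
move=> Q m M a D m0 Q0 h8 h3 hN hD hT.
have D0 : 0 < D by apply: lt_le_trans hD; rewrite divr_gt0.
have e1 : M / (4 * Q ^+ 2) <= 1 / m.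
  rewrite ler_pdivrMr ?mulr_gt0 ?exprn_gt0 // mul1r mulrC ler_pdivlMr //.
  apply: (@le_trans _ _ (2 * Q * m)); first by rewrite ler_pM2r.
  by have := ler_wpM2l (ltW Q0) h8; have := sqr_ge0 Q; lra.
have e2 : a / D <= 1900 / m.
  rewrite ler_pdivrMr // mulrAC ler_pdivlMr //.
  apply: (@le_trans _ _ (58 * m ^+ 2 * m)); first by rewrite ler_pM2r.
  have -> : 58 * m ^+ 2 * m = 58 * m ^+ 3 by ring.
  lra.
have m1 : 0 <= m^-1 by rewrite invr_ge0 ltW.
lra.
Qed.

(* The minimum is taken with default value 1, an upper bound of all the
   probabilities involved. *)
Theorem theorem10 (R : realType)
    (X : forall (n : nat) (sigma : {perm site n}) (x : site n),
       permuted_walk R sigma x) :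
  (\big[Num.min/1]_(xy : site n * site n | xy.1 != xy.2)
      uniform_perm_prob R (fun sigma : {perm site n} =>
        ((n%:R / 18)%:E <= expected_hitting_time (X n sigma xy.1) xy.2)%E))
    @[n --> \oo] --> (1 : R).
Proof.
apply/cvgrPdist_le => e e0.
(* The constant is made opaque so that its unary value is never computed. *)
have C0 : 0 <= 8 * 2000 :> R by rewrite mulr_ge0 ?ler0n.
have : exists2 C : R, 0 <= C & 8 * 2000 = C by exists (8 * 2000).
case=> C {}C0 CE; pose K := (Num.truncn (C / e) + 6)%N.
near=> n.
have Kn : (2 ^ K <= n)%N by near: n; exact: nbhs_infty_ge.
have n0 : (0 < n)%N by rewrite (leq_trans _ Kn) // expn_gt0.
set k := trunc_log 2 n.*2.+1.
have Kk : (K <= k)%N by apply: trunc_log_max => //; lia.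
have k6 : (6 <= k)%N by rewrite (leq_trans _ Kk) // leq_addl.
have [TN err] := error_bound R k6 (trunc_log_bounds (isT : 1 < 2)%N (ltn0Sn n.*2)).
set p := \big[_/_]_(_ | _) _.
have p1 : p <= 1 by exact: bigmin_le_id.
have : 1 - C / k.+1%:R <= p.
  apply/bigmin_geP; split; first by rewrite gerBl divr_ge0.
  move=> [x y] /= xy; apply: le_trans (slow_hitting_prob X n0 xy TN).
  by rewrite lerD2l lerN2 -CE -mulrA ler_pM2l ?ltr0n.
have : C / k.+1%:R <= e.
  rewrite ler_pdivrMr // mulrC -ler_pdivrMr //.
  have /ltW/le_trans := truncnS_gt (C / e); apply.
  by rewrite ler_nat ltnS (leq_trans _ Kk) // leq_addr.
move: (C / _) => r h1 h2; rewrite ger0_norm ?subr_ge0 //.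
by apply: le_trans h1; rewrite lerBlDr addrC -lerBlDr.
Unshelve. all: by end_near.
Qed.
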